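(* Let $\Psi\colon\mathbb{R}^n\to\mathbb{R}^m$ be a vector positively homogeneous function with components $\psi_1,\dots,\psi_m$ such that, for every $i=1,\dots,m$, $\psi_i(z)\ge 0$ for all $z\in\mathbb{R}^{n_i}$ and $\psi_i(z)>0$ whenever $z\ne 0$. Let $c\in\mathbb{R}^n$, $d\in\mathbb{R}^m$, $b\in\mathbb{R}^k$, $p\in\mathbb{R}^\ell$, $A\in\mathbb{R}^{k\times n}$, $B\in\mathbb{R}^{k\times m}$, $H\in\mathbb{R}^{\ell\times n}$, $K\in\mathbb{R}^{\ell\times m}$. Consider the primal problem $$(\mathrm{P})\quad \min_x\ c^Tx+d^T\Psi(x)\quad\text{s.t.}\quad Ax+B\Psi(x)=b,\ \ Hx+K\Psi(x)\ge p,$$ and the positively homogeneous dual problem $$(\mathrm{D})\quad \max_{u,v}\ b^Tu+p^Tv\quad\text{s.t.}\quad \Psi^*(A^Tu+H^Tv-c)+B^Tu+K^Tv\le d,\ \ v\ge 0.$$ Then for every feasible point $x\in\mathbb{R}^n$ of $(\mathrm{P})$ and every feasible point $(u,v)\in\mathbb{R}^k\times\mathbb{R}^\ell$ of $(\mathrm{D})$, $$c^Tx+d^T\Psi(x)\ \ge\ b^Tu+p^Tv.$$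
   Context: A function $\psi\colon\mathbb{R}^{q}\to\mathbb{R}$ is positively homogeneous if $\psi(\lambda x)=\lambda\psi(x)$ for all $x\in\mathbb{R}^q$ and all real $\lambda>0$. A map $\Psi\colon\mathbb{R}^n\to\mathbb{R}^m$ is vector positively homogeneous if $\Psi(x)=(\psi_1(x_{I_1}),\dots,\psi_m(x_{I_m}))^T$ for all $x$, where $I_1,\dots,I_m\subseteq\{1,\dots,n\}$ are pairwise disjoint with $\#I_i=n_i\ge 1$, $n=n_1+\cdots+n_m$, $x_{I_i}\in\mathbb{R}^{n_i}$ is the subvector of $x$ with entries indexed by $I_i$, and each $\psi_i\colon\mathbb{R}^{n_i}\to\mathbb{R}$ is positively homogeneous. The dual of a positively homogeneous $\psi$ is $\psi^*(y)=\sup\{x^Ty : \psi(x)\le 1\}\in\mathbb{R}\cup\{\infty\}$, and the dual of $\Psi$ is $\Psi^*(y)=(\psi_1^*(y_{I_1}),\dots,\psi_m^*(y_{I_m}))^T$. Vector inequalities are componentwise (a constraint with an infinite left-hand side component is violated). *)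

(* Defs.v *)
From HB Require Import structures.
From mathcomp Require Import all_boot all_order all_algebra.
From mathcomp Require Import all_classical all_reals ereal.

Set Implicit Arguments.
Unset Strict Implicit.
Unset Printing Implicit Defensive.

Import Order.TTheory GRing.Theory Num.Theory.
Local Open Scope ring_scope.

Definition pos_homogeneous (R : realType) (q : nat) (f : 'cV[R]_q -> R) : Prop :=
  forall (a : R) (x : 'cV[R]_q), 0 < a -> f (a *: x) = a * f x.

Definition dot (R : realType) (q : nat) (x y : 'cV[R]_q) : R := (x^T *m y) 0 0.

(* The entries of [x] indexed by [I], in increasing order of the indices. *)
Definition subvec (R : realType) (n : nat) (I : {set 'I_n}) (x : 'cV[R]_n) :
    'cV[R]_#|I| :=
  \col_(j < #|I|) x (enum_val j) 0.

(* [ph_dual f y] is never -oo when [f] is positively homogeneous, since then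
   [f 0 = 0]. *)
Definition ph_dual (R : realType) (q : nat) (f : 'cV[R]_q -> R) (y : 'cV[R]_q) :
    \bar R :=
  ereal_sup [set (dot x y)%:E | x in [set x : 'cV[R]_q | f x <= 1%R]]%classic.

(* [vph_card] together with [vph_disjoint] makes the index sets a partition of
   'I_n. *)
Record vec_pos_hom (R : realType) (n m : nat) := VecPosHom {
  vph_idx : 'I_m -> {set 'I_n};
  vph_comp : forall i : 'I_m, 'cV[R]_#|vph_idx i| -> R;
  vph_disjoint : forall i j : 'I_m, i != j -> [disjoint vph_idx i & vph_idx j];
  vph_nonempty : forall i : 'I_m, (1 <= #|vph_idx i|)%N;
  vph_card : n = (\sum_(i < m) #|vph_idx i|)%N;
  vph_pos_hom : forall i : 'I_m, pos_homogeneous (@vph_comp i) }.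

Arguments vph_idx {R n m} Psi i : rename.
Arguments vph_comp {R n m} Psi i _ : rename.

Definition vph_fun (R : realType) (n m : nat) (Psi : vec_pos_hom R n m)
    (x : 'cV[R]_n) : 'cV[R]_m :=
  \col_(i < m) vph_comp Psi i (subvec (vph_idx Psi i) x).

Coercion vph_fun : vec_pos_hom >-> Funclass.

Definition vph_dual (R : realType) (n m : nat) (Psi : vec_pos_hom R n m)
    (y : 'cV[R]_n) : 'cV[\bar R]_m :=
  \col_(i < m) ph_dual (vph_comp Psi i) (subvec (vph_idx Psi i) y).

(* Componentwise order; it is also used with [T] the extended reals. *)
Definition lecv (disp : Order.disp_t) (T : porderType disp) (q : nat)
    (x y : 'cV[T]_q) : Prop :=
  forall i : 'I_q, (x i 0 <= y i 0)%O.

Definition primal_feasible (R : realType) (n m k l : nat)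
    (Psi : vec_pos_hom R n m)
    (b : 'cV[R]_k) (p : 'cV[R]_l) (A : 'M[R]_(k, n)) (B : 'M[R]_(k, m))
    (H : 'M[R]_(l, n)) (K : 'M[R]_(l, m)) (x : 'cV[R]_n) : Prop :=
  A *m x + B *m Psi x = b /\ lecv p (H *m x + K *m Psi x).

Definition dual_feasible (R : realType) (n m k l : nat)
    (Psi : vec_pos_hom R n m) (c : 'cV[R]_n) (d : 'cV[R]_m)
    (A : 'M[R]_(k, n)) (B : 'M[R]_(k, m))
    (H : 'M[R]_(l, n)) (K : 'M[R]_(l, m)) (u : 'cV[R]_k) (v : 'cV[R]_l) : Prop :=
  lecv (vph_dual Psi (A^T *m u + H^T *m v - c)
        + map_mx EFin (B^T *m u) + map_mx EFin (K^T *m v))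
       (map_mx EFin d)
  /\ lecv 0 v.

(* Main.v *)
(* Normalizing z to z / psi(z) gives z^T y <= psi(z) t whenever psi^*(y) <= t.
   Summing this over the blocks I_i turns the dual constraint into
   x^T (A^T u + H^T v - c) <= (d - B^T u - K^T v)^T Psi(x), and the primal
   constraints, paired with u and with v >= 0, do the rest. *)
Require Import Defs.
From HB Require Import structures.
From mathcomp Require Import all_boot all_order all_algebra.
From mathcomp Require Import all_classical all_reals ereal.
From mathcomp Require Import lra.

Set Implicit Arguments.
Unset Strict Implicit.
Unset Printing Implicit Defensive.

Import Order.TTheory GRing.Theory Num.Theory.
Local Open Scope ring_scope.

Lemma dotE (R : realType) (q : nat) (x y : 'cV[R]_q) :
  dot x y = \sum_i x i 0 * y i 0.
Proof. by rewrite /dot mxE; apply: eq_bigr => i _; rewrite mxE. Qed.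

Lemma dotC (R : realType) (q : nat) (x y : 'cV[R]_q) : dot x y = dot y x.
Proof. by rewrite !dotE; apply: eq_bigr => i _; rewrite mulrC. Qed.

Lemma dotDl (R : realType) (q : nat) (x y z : 'cV[R]_q) :
  dot (x + y) z = dot x z + dot y z.
Proof. by rewrite /dot raddfD mulmxDl mxE. Qed.

Lemma dotZl (R : realType) (q : nat) (a : R) (x y : 'cV[R]_q) :
  dot (a *: x) y = a * dot x y.
Proof. by rewrite /dot linearZ -scalemxAl mxE. Qed.

Lemma dotDr (R : realType) (q : nat) (x y z : 'cV[R]_q) :
  dot x (y + z) = dot x y + dot x z.
Proof. by rewrite /dot mulmxDr mxE. Qed.

Lemma dotNr (R : realType) (q : nat) (x y : 'cV[R]_q) :
  dot x (- y) = - dot x y.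
Proof. by rewrite /dot mulmxN mxE. Qed.

Lemma dot0l (R : realType) (q : nat) (y : 'cV[R]_q) : dot 0 y = 0.
Proof. by rewrite /dot trmx0 mul0mx mxE. Qed.

Lemma dot_trmx (R : realType) (q r : nat) (M : 'M[R]_(r, q))
    (x : 'cV[R]_q) (y : 'cV[R]_r) : dot x (M^T *m y) = dot (M *m x) y.
Proof. by rewrite /dot trmx_mul mulmxA. Qed.

Lemma ler_dot (R : realType) (q : nat) (x y z : 'cV[R]_q) :
  lecv x y -> lecv 0 z -> dot x z <= dot y z.
Proof.
move=> xy z0; rewrite !dotE; apply: ler_sum => i _.
by apply: ler_wpM2r; [have := z0 i; rewrite mxE | exact: xy].
Qed.

(** The scalar 0 is excluded from homogeneity, so the factor 2 is used instead: [f 0 = f 0 + f 0],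
    and cancelling leaves 0. *)
Lemma pos_homogeneous0 (R : realType) (q : nat) (f : 'cV[R]_q -> R) :
  pos_homogeneous f -> f 0 = 0.
Proof.
move=> /(_ 2 0 (ltr0Sn _ _)); rewrite scaler0 mulr_natl mulr2n => /eqP.
by rewrite -[X in X == _]addr0 (inj_eq (addrI _)) eq_sym => /eqP.
Qed.

Lemma dot_le_ph_dual (R : realType) (q : nat) (f : 'cV[R]_q -> R)
    (x y : 'cV[R]_q) (t : R) :
  pos_homogeneous f -> (forall z, z != 0 -> 0 < f z) ->
  (ph_dual f y <= t%:E)%E -> dot x y <= t * f x.
Proof.
(* The origin cannot be normalized; there both sides vanish. *)
move=> fhom fgt0 yt; have [->|x0] := eqVneq x 0.
  by rewrite dot0l pos_homogeneous0// mulr0.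
have fx0 := fgt0 _ x0.
suff : dot ((f x)^-1 *: x) y <= t by rewrite dotZl ler_pdivrMl// mulrC.
rewrite -lee_fin; apply: le_trans yt; apply: ereal_sup_ubound.
(* By homogeneity [f] equals exactly 1 at this point, so it competes in the supremum. *)
exists ((f x)^-1 *: x) => //=.
by rewrite fhom ?invr_gt0// mulVf ?gt_eqF.
Qed.

(** Disjoint index sets whose cardinalities add up to [n] have a union of size [n], hence cover
    ['I_n]; the sum over all coordinates then regroups by blocks. *)
Lemma dot_subvec (R : realType) (n m : nat) (Psi : vec_pos_hom R n m)
    (x y : 'cV[R]_n) :
  dot x y = \sum_i dot (subvec (vph_idx Psi i) x) (subvec (vph_idx Psi i) y).
Proof.
have cover_card : #|\bigcup_i vph_idx Psi i| = n.
  rewrite [RHS](vph_card Psi) -sum1_card.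
  rewrite (partition_disjoint_bigcup _ (fun=> 1%N) (@vph_disjoint _ _ _ Psi)).
  by apply: eq_bigr => i _; rewrite sum1_card.
have coverT : \bigcup_i vph_idx Psi i = [set: 'I_n]%SET.
  by apply/eqP; rewrite eqEcard finset.subsetT cardsT card_ord cover_card leqnn.
rewrite dotE (eq_bigl (mem (\bigcup_i vph_idx Psi i))); last first.
  by move=> i /=; rewrite coverT finset.in_setT.
rewrite (partition_disjoint_bigcup _ _ (@vph_disjoint _ _ _ Psi)).
(* Reindexing by [enum_val] matches the order in which [subvec] lists the entries of a block. *)
apply: eq_bigr => i _; rewrite dotE [LHS]big_enum_val.
by apply: eq_bigr => j _; rewrite !mxE.
Qed.

Theorem theorem2 (R : realType) (n m k l : nat) (Psi : vec_pos_hom R n m)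
    (Psi_ge0 : forall (i : 'I_m) (z : 'cV[R]_#|vph_idx Psi i|),
       0 <= vph_comp Psi i z)
    (Psi_gt0 : forall (i : 'I_m) (z : 'cV[R]_#|vph_idx Psi i|),
       z != 0 -> 0 < vph_comp Psi i z)
    (c : 'cV[R]_n) (d : 'cV[R]_m) (b : 'cV[R]_k) (p : 'cV[R]_l)
    (A : 'M[R]_(k, n)) (B : 'M[R]_(k, m))
    (H : 'M[R]_(l, n)) (K : 'M[R]_(l, m))
    (x : 'cV[R]_n) (u : 'cV[R]_k) (v : 'cV[R]_l) :
  primal_feasible Psi b p A B H K x ->
  dual_feasible Psi c d A B H K u v ->
  dot b u + dot p v <= dot c x + dot d (Psi x).
Proof.
move=> [Ab Hp] [dual v0].
have dual_le : dot x (A^T *m u + H^T *m v - c)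
    <= dot (d - B^T *m u - K^T *m v) (Psi x).
  rewrite (dot_subvec Psi) dotE; apply: ler_sum => i _; rewrite [Psi x i 0]mxE.
  apply: dot_le_ph_dual; [exact: vph_pos_hom | exact: Psi_gt0 |].
  have := dual i; rewrite !mxE.
  (* The value [+oo] contradicts the dual constraint, [-oo] lies below any bound, and a finite value
     leaves a real inequality to rearrange. *)
  case: (ph_dual _ _) => [r| |]; rewrite ?leNye//.
  rewrite -!EFinD !lee_fin.
  lra.
have := ler_dot Hp v0; rewrite -Ab.
move: dual_le; rewrite !(dotDr, dotNr, dotDl, dot_trmx).
(* Moving [Psi x] to the left lets [dot_trmx] shift [B] and [K] onto it, so all inequalities share
   the same scalar products and their sum is the claim. *)
rewrite ![dot _ (Psi x)]dotC !(dotDr, dotNr, dot_trmx) (dotC x c).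
lra.
Qed.
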